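(* Let $\{\mu_\theta\}_{\theta\in\Theta}$ be a family of Borel probability measures on $\mathbb{R}^d$ and let $\mu_{\mathrm{mix}}$ be its mixture with respect to a mixing probability measure $m$ on $\Theta$. Suppose that the measures $\mu_\theta$ satisfy the convex log-Sobolev inequality with uniformly bounded constants: $$C_\Theta:=\sup_{\theta\in\Theta}C_{\mathrm{LS}}^{\mathrm{conv}}(\mu_\theta)<\infty .$$ Suppose moreover that $$M_\Theta:=\sup_{\theta,\theta'\in\Theta}\chi^2(\mu_\theta\Vert\mu_{\theta'})<\infty .$$ Then $\mu_{\mathrm{mix}}$ satisfies the convex log-Sobolev inequality and $$C_{\mathrm{LS}}^{\mathrm{conv}}(\mu_{\mathrm{mix}})\le\sup_{\theta\in\Theta}C_{\mathrm{LS}}^{\mathrm{conv}}(\mu_\theta)\cdot\Bigl(2+\tfrac14(2+M_\Theta)\log(1+M_\Theta)\Bigr).$$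
   Context: Mixture: $(\Theta,\mathfrak{M},m)$ is a probability space, for every Borel set $A\subset\mathbb{R}^d$ the map $\theta\mapsto\mu_\theta(A)$ is measurable, and $\mu_{\mathrm{mix}}(A):=\int_\Theta \mu_\theta(A)\,dm(\theta)$ for Borel $A\subset\mathbb{R}^d$. $\chi^2(\mu_1\Vert\mu_2):=\int\bigl(\frac{d\mu_1}{d\mu_2}-1\bigr)^2d\mu_2$ if $\mu_1\ll\mu_2$ and $+\infty$ otherwise. $\mathrm{Ent}_\mu(g):=\int g\log g\,d\mu-\int g\,d\mu\,\log(\int g\,d\mu)$ for $g\ge0$. A probability measure $\mu$ on $\mathbb{R}^d$ satisfies the convex log-Sobolev inequality with constant $C\in(0,\infty)$ if $$\mathrm{Ent}_\mu(e^f)\le\frac C2\int_{\mathbb{R}^d}|\nabla f|^2e^f\,d\mu$$ for all convex functions $f:\mathbb{R}^d\to\mathbb{R}$ which are $C^1$, Lipschitz and bounded from below. $C_{\mathrm{LS}}^{\mathrm{conv}}(\mu)$ is the optimal such constant (infimum; $+\infty$ if there is none). Convention: an estimate $A\le B$ means that if $B<\infty$, then $A$ is well defined (in particular $e^f\in L^1(\mu)$) and the inequality holds. *)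

(* Defs.v *)
From HB Require Import structures.
From mathcomp Require Import all_boot all_order all_algebra.
From mathcomp Require Import all_classical all_reals all_analysis measurable_realfun.

Set Implicit Arguments.
Unset Strict Implicit.
Unset Printing Implicit Defensive.

Import Order.TTheory GRing.Theory Num.Theory.
Import numFieldNormedType.Exports.

Local Open Scope classical_set_scope.
Local Open Scope charge_scope.
Local Open Scope ring_scope.
Local Open Scope ereal_scope.

(* R^d with its Borel sigma-algebra. *)
Notation borel_rV R d := (g_sigma_algebraType (@open 'rV[R]_d)).

Section mixture.
Context {dT dX} {Theta : measurableType dT} {X : measurableType dX}
  {R : realType}.
Implicit Types (m : probability Theta R) (mu : Theta -> probability X R).

Definition measurable_family mu : Prop := forall A : set X, measurable A ->
  measurable_fun [set: Theta] (fun theta => mu theta A : \bar R).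

(* The proof of measurability is not needed to define the set function, but it
   is what makes it a probability measure below. *)
Definition mixture m mu of measurable_family mu : set X -> \bar R :=
  fun A => \int[m]_theta mu theta A.

Variables (m : probability Theta R) (mu : Theta -> probability X R).
Hypothesis mmu : measurable_family mu.

Let mix := mixture m mmu.

Let mix0 : mix set0 = 0.
Proof. by rewrite /mix /mixture integral0_eq. Qed.

Let mix_ge0 A : 0 <= mix A.
Proof. by rewrite /mix /mixture integral_ge0. Qed.

Let mix_semi_sigma_additive : semi_sigma_additive mix.
Proof.
move=> F mF tF mUF; rewrite /mix /mixture.
rewrite [X in _ --> X](_ : _ =
    \int[m]_theta \sum_(0 <= k <oo) mu theta (F k)); last first.
  apply: eq_integral => theta _.
  by apply/esym/cvg_lim => //; exact: measure_semi_sigma_additive.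
rewrite [X in X @ _](_ : _ =
    (fun n => \int[m]_theta \sum_(0 <= i < n) mu theta (F i))); last first.
  by apply/funext => n; rewrite ge0_integral_sum// => i; exact: mmu.
apply: cvg_monotone_convergence => //.
- by move=> n; apply: emeasurable_sum => i; exact: mmu.
- by move=> n x _; rewrite sume_ge0.
- by move=> x _ k n kn; exact: ereal_nondecreasing_series.
Qed.

HB.instance Definition _ := isMeasure.Build _ _ _ (mixture m mmu)
  mix0 mix_ge0 mix_semi_sigma_additive.

Let mix_setT : mix [set: X] = 1.
Proof.
rewrite /mix /mixture (eq_integral (cst 1)); last first.
  by move=> theta _; exact: probability_setT.
by rewrite integral_cst// mul1e; exact: probability_setT.
Qed.

HB.instance Definition _ :=
  Measure_isProbability.Build _ _ _ (mixture m mmu) mix_setT.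

End mixture.

Section divergences.
Context {dX} {X : measurableType dX} {R : realType}.

Definition chi2 (mu1 mu2 : probability X R) : \bar R :=
  if `[< mu1 `<< mu2 >] then
    \int[mu2]_x ('d (charge_of_finite_measure mu1) '/d mu2 x - 1) ^+ 2
  else +oo.

(* The conventions [ln 0 = 0] and [0 * -oo = 0] give [0 log 0 = 0] in both
   terms. *)
Definition Ent (mu : probability X R) (g : X -> R) : \bar R :=
  \int[mu]_x (g x * ln (g x))%:E -
  (\int[mu]_x (g x)%:E) * lne (\int[mu]_x (g x)%:E).

End divergences.

Section convex_log_sobolev.
Context {R : realType} {d : nat}.

Definition gradient (f : 'rV[R]_d -> R) (x : 'rV[R]_d) : 'rV[R]_d :=
  (\row_i 'D_(delta_mx 0 i) f x)%R.

(* The norm of ['rV[R]_d] is the sup norm, hence the explicit sum. *)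
Definition euclidean_sqnorm (v : 'rV[R]_d) : R := (\sum_i v 0 i ^+ 2)%R.

Definition C1 (f : 'rV[R]_d -> R) : Prop :=
  (forall x, differentiable f x) /\ continuous (gradient f).

(* [lipschitz] refers to the sup norm; all norms being equivalent, this is the
   Lipschitz property for the Euclidean norm. *)
Definition clsi_test (f : 'rV[R]_d -> R) : Prop :=
  [/\ convex_function [set: 'rV[R]_d] f, C1 f, lipschitz f
    & has_lbound (range f)].

Definition fisher (mu : probability (borel_rV R d) R) (f : 'rV[R]_d -> R) :
    \bar R :=
  \int[mu]_x (euclidean_sqnorm (gradient f x) * expR (f x))%:E.

(* The inequality is required only when its right-hand side is finite, and then
   includes [e^f \in L^1(mu)].  Since [t log t] is bounded below, [Ent] is
   then well defined in [0, +oo]. *)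
Definition clsi (mu : probability (borel_rV R d) R) (C : R) : Prop :=
  (0 < C)%R /\
  forall f : 'rV[R]_d -> R, clsi_test f ->
    (C / 2)%:E * fisher mu f < +oo ->
    mu.-integrable setT (fun x => (expR (f x))%:E) /\
    Ent mu (fun x => expR (f x)) <= (C / 2)%:E * fisher mu f.

Definition clsi_constant (mu : probability (borel_rV R d) R) : \bar R :=
  ereal_inf [set C%:E | C in clsi mu].

End convex_log_sobolev.

(* Main.v *)
Require Import Defs.
From HB Require Import structures.
From mathcomp Require Import all_boot all_order all_algebra.
From mathcomp Require Import all_classical all_reals all_analysis measurable_realfun.
From mathcomp Require Import giry ring lra.

Set Implicit Arguments.
Unset Strict Implicit.
Unset Printing Implicit Defensive.

Import Order.TTheory GRing.Theory Num.Theory.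
Import numFieldNormedType.Exports.

Local Open Scope classical_set_scope.

(** Let [g = e^f] and [h = e^(f/2)], so that [g = h^2]. For every constant
    [T > 0], the entropy of [g] under any probability is at most the integral
    of the Bregman divergence [g ln (g/T) - g + T] (lemma [Ent_le_bregman]),
    and, unlike the entropy, that integral is linear in the measure. The
    theorem therefore reduces to finding one [T], the same for all components,
    such that
      [int (g ln (g/T) - g + T) dmu_theta <= (2 + r) Ent_(mu_theta)(g)],
    with [r = (2 + M) ln (1 + M) / 4]: the right-hand side is at most
    [(2 + r) (C/2)] times the Fisher term of [mu_theta], and integrating over
    [theta] gives the inequality for the mixture with constant [C (2 + r)].

    For a fixed component write [u] and [p] for the means of [h^2] and [h],
    [V = u - p^2] for the variance of [h], and [E] for the entropy of [h^2].
    The left-hand side above is [E + (u ln (u/T) - u + T)], and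
    [u ln (u/T) = u ln (u/p^2) + u ln (p^2/T)]. Two facts relate these
    quantities.
    - Jensen's inequality for the probability of density proportional to [h^2]
      gives [u ln (u/p^2) <= E], and in particular [V <= E]
      ([norm_ratio_le_entropy], [variance_le_norm_ratio]): the entropy of [h^2]
      controls the variance of [h].
    - By the Cauchy-Schwarz inequality applied to [h - p] and the centred
      density, two components satisfy [(p' - p)^2 <= M V]
      ([mean_gap_chi2]). Hence the means [p] have finite supremum [s] and
      infimum [i], and each component pays for its distance to both extremes:
      [(s - p)^2 <= M V] and [(p - i)^2 <= M V].

    With [T = (s^2 + i^2) / 2] what remains is an inequality between real
    numbers, [u ln (p^2/T) - u + T <= r V] ([two_norms_gap]); it gives the bound
    [2 E + r V <= (2 + r) E]. A component with infinite Fisher term satisfies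
    the bound by its Fisher term trivially, so this bound holds for every
    [theta] and can be integrated. *)

(** * Logarithmic inequalities *)

Section calculus.
Local Open Scope ring_scope.
Variable R : realType.
Implicit Types x y : R.

Lemma ln_le_subr1 x : 0 < x -> ln x <= x - 1.
Proof.
move=> x0; have -> : ln x = ln (1 + (x - 1)) by congr ln; ring.
by apply: le_ln1Dx; lra.
Qed.

Lemma ln_ge_1subV x : 0 < x -> 1 - x^-1 <= ln x.
Proof.
move=> x0; have /ln_le_subr1 : 0 < x^-1 by rewrite invr_gt0.
by rewrite lnV ?posrE//; lra.
Qed.

Lemma ger0_derive_ge1 (F dF : R -> R) :
  (forall x, 0 < x -> is_derive x 1 F (dF x)) ->
  (forall x, 1 <= x -> 0 <= dF x) -> F 1 = 0 ->
  forall x, 1 <= x -> 0 <= F x.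
Proof.
move=> dFE dF0 F1 x x1; rewrite -F1.
apply: (@ger0_derive1_ndecr _ F 1 x) => //.
- move=> y; rewrite in_itv/= => /andP[y1 _].
  have y0 : 0 < y by lra.
  by case: (dFE y y0).
- move=> y; rewrite in_itv/= => /andP[y1 _].
  have y0 : 0 < y by lra.
  rewrite derive1E; case: (dFE y y0) => _ ->.
  by apply: dF0; lra.
- apply: continuous_in_subspaceT => y; rewrite inE/= in_itv/= => /andP[y1 _].
  have y0 : 0 < y by lra.
  apply/differentiable_continuous/derivable1_diffP.
  by case: (dFE y y0).
Qed.

(** Multiplying the Pade bound by [x + 1] keeps the derivative free of
    quotients: it is [ln x + 1/x - 1 >= 0]. *)
Lemma ln_ge_pade x : 1 <= x -> 2 * (x - 1) <= (x + 1) * ln x.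
Proof.
move=> x1; rewrite -subr_ge0.
pose F y : R := (y + 1) * ln y - 2 * (y - 1).
apply: (@ger0_derive_ge1 F (fun y => ln y + y^-1 - 1)) => //.
- move=> y y0; have lny := is_derive1_ln y0; rewrite /F.
  apply: is_derive_eq; rewrite /GRing.scale/=.
  by field; rewrite gt_eqF.
- by move=> y y1; have := @ln_ge_1subV y; lra.
- by rewrite /F ln1; ring.
Qed.

Lemma xlnx_le x : 1 <= x -> 2 * (x * ln x) <= x ^+ 2 - 1.
Proof.
move=> x1; rewrite -subr_ge0.
pose F y : R := y ^+ 2 - 1 - 2 * (y * ln y).
apply: (@ger0_derive_ge1 F (fun y => 2 * (y - 1 - ln y))) => //.
- move=> y y0; have lny := is_derive1_ln y0; rewrite /F.
  apply: is_derive_eq; rewrite /GRing.scale/=.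
  by field; rewrite gt_eqF.
- by move=> y y1; have := @ln_le_subr1 y; lra.
- by rewrite /F ln1; ring.
Qed.

Lemma ln_le_pade x : 0 < x <= 1 -> (x + 1) * ln x <= 2 * (x - 1).
Proof.
move=> /andP[x0 x1].
have := @ln_ge_pade x^-1; rewrite invf_ge1// => /(_ x1).
rewrite lnV ?posrE// => H.
have : 2 * (x^-1 - 1) * x <= (x^-1 + 1) * - ln x * x by rewrite ler_pM2r.
have -> : 2 * (x^-1 - 1) * x = 2 * (1 - x) by field; rewrite gt_eqF.
have -> : (x^-1 + 1) * - ln x * x = - ((x + 1) * ln x) by field; rewrite gt_eqF.
lra.
Qed.

(** * The comparison of means *)

(** The level [T] is the midpoint of [s^2] and [i^2], not the square of a mean
    of [s] and [i]. This makes [p^2 <= 2 T] for every [p] in [[i, s]] and still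
    puts [T] so close to the middle that [(p^2 - T)^2 / T] is controlled by the
    square of the larger distance from [p] to the endpoints. Below the level
    the weight [T + p^2] sharpens the constant, which is attained at [p = i],
    [s = 3 i]. *)
Lemma midsquare_lower (s i p W : R) (T := (s ^+ 2 + i ^+ 2) / 2) :
  0 <= i -> i <= p -> p <= s -> p ^+ 2 <= T ->
  (s - p) ^+ 2 <= W -> (p - i) ^+ 2 <= W ->
  3 * (T - p ^+ 2) ^+ 2 <= 2 * W * (T + p ^+ 2).
Proof.
move=> i0 ip ps pT sW iW.
set D := T - p ^+ 2; have D0 : 0 <= D by rewrite /D; lra.
have -> : T + p ^+ 2 = D + 2 * p ^+ 2 by rewrite /D; ring.
pose a := s - p; pose b := p - i.
have a0 : 0 <= a by rewrite /a; lra.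
have b0 : 0 <= b by rewrite /b; lra.
have bp : b <= p by rewrite /b; lra.
have DE : 2 * D = a * (2 * p + a) - b * (2 * p - b).
  by rewrite /D /T /a /b; field.
have p2 : 0 <= D + 2 * p ^+ 2 by rewrite addr_ge0// mulr_ge0// sqr_ge0.
rewrite -/a in sW; rewrite -/b in iW.
have [ab|/ltW ba] := leP b a.
- suff : 3 * D ^+ 2 <= 2 * a ^+ 2 * (D + 2 * p ^+ 2).
    move=> /le_trans; apply; apply: ler_wpM2r => //; lra.
  (* [E] is the value of [D] at [b = 0], i.e. at [p = i], the worst case: the
     difference of the two sides, as a function of [D], is monotone as soon as
     [3 * D >= a ^+ 2]. *)
  pose E := a * (2 * p + a) / 2.
  have DleE : D <= E.
    suff : 0 <= b * (2 * p - b) by rewrite /E; lra.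
    by rewrite mulr_ge0//; lra.
  have HE : 3 * E ^+ 2 <= 2 * a ^+ 2 * (E + 2 * p ^+ 2).
    rewrite -subr_ge0.
    have -> : 2 * a ^+ 2 * (E + 2 * p ^+ 2) - 3 * E ^+ 2
      = (a * (p - a / 2)) ^+ 2 by rewrite /E; field.
    exact: sqr_ge0.
  have [D1|D1] := leP (3 * D) (2 * a ^+ 2).
    have : D * (3 * D) <= D * (2 * a ^+ 2) by rewrite ler_wpM2l.
    have : 0 <= a ^+ 2 * p ^+ 2 by rewrite mulr_ge0// sqr_ge0.
    by lra.
  have : 0 <= (E - D) * (3 * (E + D) - 2 * a ^+ 2).
    rewrite mulr_ge0//; first by lra.
    have := sqr_ge0 a; lra.
  by lra.
- suff : 3 * D ^+ 2 <= 2 * b ^+ 2 * (D + 2 * p ^+ 2).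
    move=> /le_trans; apply; apply: ler_wpM2r => //; lra.
  have Db : D <= b ^+ 2 by nra.
  have bp2 : b ^+ 2 <= p ^+ 2 by rewrite ler_sqr// nnegrE; lra.
  have h1 : D ^+ 2 <= b ^+ 2 * D by rewrite expr2 ler_wpM2r.
  have h2 : b ^+ 2 * D <= b ^+ 2 * p ^+ 2.
    by rewrite ler_wpM2l// ?sqr_ge0//; lra.
  have h3 : 0 <= b ^+ 2 * p ^+ 2 by rewrite mulr_ge0// sqr_ge0.
  clearbody D b; lra.
Qed.

Lemma midsquare_upper (s i p W : R) (T := (s ^+ 2 + i ^+ 2) / 2) :
  0 <= i -> i <= p -> p <= s -> T <= p ^+ 2 ->
  (p - i) ^+ 2 <= W -> (p ^+ 2 - T) ^+ 2 <= W * T.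
Proof.
move=> i0 ip ps pT iW.
have T0 : 0 <= T by rewrite /T; have := sqr_ge0 s; have := sqr_ge0 i; lra.
have [H1 H2] : p ^+ 2 - T <= (p - i) * ((p + i) / 2) /\ ((p + i) / 2) ^+ 2 <= T.
  split; first by rewrite /T; nra.
  have h1 : p ^+ 2 <= s ^+ 2 by rewrite ler_sqr ?nnegrE//; lra.
  rewrite /T; have := sqr_ge0 (p - i); lra.
have H3 : (p ^+ 2 - T) ^+ 2 <= ((p - i) * ((p + i) / 2)) ^+ 2.
  by rewrite ler_sqr// nnegrE; lra.
rewrite (le_trans H3)// exprMn; apply: ler_pM => //; exact: sqr_ge0.
Qed.

(** With [x = p^2 / T], the left-hand side splits into [V (ln x - 1)] and
    [T (x ln x - x + 1)]. The first term is nonpositive since [x <= 2], and is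
    at most [- V] if [x <= 1]. The second is at most [M V / 2] if [x >= 1] and at
    most [2 M V / 3] if [x <= 1]: this is where the two conditions on [r] come
    from. *)
Lemma two_norms_gap (s i p V M r : R) (T := (s ^+ 2 + i ^+ 2) / 2) :
  0 < i -> i <= p -> p <= s -> 0 <= V ->
  (s - p) ^+ 2 <= M * V -> (p - i) ^+ 2 <= M * V ->
  M <= 2 * r -> 2 * M <= 3 * (1 + r) ->
  (p ^+ 2 + V) * ln (p ^+ 2 / T) - (p ^+ 2 + V) + T <= r * V.
Proof.
move=> i0 ip ps V0 sM iM Mr Mr'.
have p0 : 0 < p by lra.
have T0 : 0 < T.
  rewrite /T; have := exprn_gt0 2 i0; have := sqr_ge0 s; lra.
set x := p ^+ 2 / T.
have x0 : 0 < x by rewrite /x divr_gt0// exprn_gt0.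
have pE : p ^+ 2 = T * x by rewrite /x; field; rewrite gt_eqF.
have -> : (p ^+ 2 + V) * ln x - (p ^+ 2 + V) + T =
  V * (ln x - 1) + T * (x * ln x - x + 1) by rewrite pE; ring.
have [x1|/ltW x1] := leP x 1.
- have pT : p ^+ 2 <= T by rewrite pE ger_pMr.
  have := @midsquare_lower s i p (M * V) (ltW i0) ip ps pT sM iM.
  rewrite -/T pE => H.
  have x10 : 0 < 1 + x by lra.
  have {}H : 3 * (T * (1 - x) ^+ 2) <= 2 * (M * V) * (1 + x).
    rewrite -(ler_pM2l T0); lra.
  have J : (1 + x) * (x * ln x - x + 1) <= (1 - x) ^+ 2.
    have := @ln_le_pade x; rewrite x0 x1 => /(_ isT).
    move=> /(ler_wpM2l (ltW x0)); lra.
  have TJ : 3 * (T * (x * ln x - x + 1)) <= 2 * (M * V).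
    rewrite -(ler_pM2l x10).
    move: J => /(ler_wpM2l (ltW T0)); lra.
  have lnx : V * ln x <= 0 by rewrite mulr_ge0_le0// ln_le0.
  have : 2 * M * V <= 3 * (1 + r) * V by rewrite ler_wpM2r.
  lra.
- have pT : T <= p ^+ 2 by rewrite pE ler_peMr// ltW.
  have := @midsquare_upper s i p (M * V) (ltW i0) ip ps pT iM.
  rewrite -/T pE => H.
  have {}H : T * (x - 1) ^+ 2 <= M * V.
    rewrite -(ler_pM2l T0); lra.
  have J := @xlnx_le x x1.
  have TJ : 2 * (T * (x * ln x - x + 1)) <= T * (x - 1) ^+ 2.
    move: J => /(ler_wpM2l (ltW T0)); lra.
  have x2 : x <= 2.
    rewrite /x ler_pdivrMr// /T.
    have : p ^+ 2 <= s ^+ 2 by rewrite ler_sqr ?nnegrE//; lra.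
    have := sqr_ge0 i; lra.
  have lnx : V * (ln x - 1) <= 0.
    by rewrite mulr_ge0_le0//; have := @ln_le_subr1 x x0; lra.
  have : M * V <= 2 * r * V by rewrite ler_wpM2r.
  lra.
Qed.

Lemma mulDln_ge (M : R) : 0 <= M -> 2 * M <= (2 + M) * ln (1 + M).
Proof.
move=> M0; have := @ln_ge_pade (1 + M).
rewrite lerDl => /(_ M0).
have -> : 1 + M + 1 = 2 + M by ring.
lra.
Qed.

(** The bound [ln (1 + M) >= 2 M / (2 + M)] is too weak for large [M]. Applied
    to the square root of [1 + M], the same Pade bound suffices: with [y] this
    root, the claim becomes [y^3 - 5 y^2 + 8 y + 2 >= 0]. *)
Lemma mulDln_ge_far (M : R) : 0 <= M ->
  8 * M <= 12 + 3 * ((2 + M) * ln (1 + M)).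
Proof.
move=> M0; set y := Num.sqrt (1 + M).
have y1 : 1 <= y by rewrite /y -[leLHS]sqrtr1 ler_sqrt; lra.
have yE : 1 + M = y ^+ 2 by rewrite sqr_sqrtr//; lra.
have -> : 2 + M = y ^+ 2 + 1 by rewrite -yE; ring.
rewrite yE lnXn; last by lra.
have -> : M = y ^+ 2 - 1 by rewrite -yE; ring.
clearbody y.
have H := @ln_ge_pade y y1.
have y2 : 0 <= y ^+ 2 + 1 by have := sqr_ge0 y; lra.
have : 0 < y * ((y - 5 / 2) ^+ 2 + 7 / 4) + 2.
  have := sqr_ge0 (y - 5 / 2) => y3.
  have : 0 <= y * ((y - 5 / 2) ^+ 2 + 7 / 4) by rewrite mulr_ge0//; lra.
  by lra.
have y10 : 0 < y + 1 by lra.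
move: H => /(ler_wpM2l y2) H H'.
rewrite -(ler_pM2l y10) mulr2n; lra.
Qed.

End calculus.

(** * Integration against a probability *)

Section integrability.
Local Open Scope ring_scope.
Context {d} {X : measurableType d} {R : realType}.
Variable P : probability X R.
Implicit Types F G : X -> R.

Local Notation integrable1 F := (P.-integrable [set: X] (fun x => (F x)%:E)).

Lemma integrable_cst1 (k : R) : integrable1 (fun=> k).
Proof. exact: finite_measure_integrable_cst. Qed.

Lemma integrable_add F G : integrable1 F -> integrable1 G ->
  integrable1 (fun x => F x + G x).
Proof. by move=> iF iG; apply: eq_integrable (integrableD _ iF iG). Qed.

Lemma integrable_scale (k : R) F : integrable1 F ->
  integrable1 (fun x => k * F x).
Proof. by move=> iF; apply: eq_integrable (integrableZl _ k iF). Qed.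

Lemma integrable_sub F G : integrable1 F -> integrable1 G ->
  integrable1 (fun x => F x - G x).
Proof. by move=> iF iG; apply: eq_integrable (integrableB _ iF iG). Qed.

Lemma le_integrable1 F G : measurable_fun [set: X] F ->
  (forall x, `|F x| <= G x) -> integrable1 G -> integrable1 F.
Proof.
move=> mF FG; apply: le_integrable => //; first exact/measurable_EFinP.
by move=> x _ /=; rewrite lee_fin (le_trans (FG x))// ler_norm.
Qed.

Lemma Rintegral_cst1 (k : R) : \int[P]_x k = k.
Proof. by rewrite Rintegral_cst// [X in fine X]probability_setT mulr1. Qed.

Lemma integral_Rintegral F : integrable1 F ->
  (\int[P]_x (F x)%:E = (\int[P]_x F x)%R%:E)%E.
Proof. by move=> iF; rewrite fineK//; exact: integrable_fin_num. Qed.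

(** A probability integrates the constant lower bound, so the negative part is
    under control and finiteness of the integral excludes an infinite positive
    part. *)
Lemma lbounded_integrable (a : R) F : measurable_fun [set: X] F ->
  (forall x, - a <= F x) -> (\int[P]_x (F x)%:E < +oo)%E -> integrable1 F.
Proof.
move=> mF aF Foo.
have mEF : measurable_fun setT (fun x => (F x)%:E) by exact/measurable_EFinP.
set f := fun x => (F x)%:E.
have fneg : (\int[P]_x f^\- x <= (Num.max a 0)%:E)%E.
  rewrite (@le_trans _ _ (\int[P]_x (Num.max a 0)%:E)%E)//.
    apply: ge0_le_integral => //.
    - exact: measurable_funeneg.
    - move=> x _; rewrite /f funenegE -EFinN -EFin_max lee_fin.
      by rewrite ge_max !le_max lexx orbT andbT lerNl aF.
  by rewrite integral_cst// [X in (_ * X)%E]probability_setT mule1.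
have fpos : (\int[P]_x f^\+ x < +oo)%E.
  rewrite ltNge leye_eq; apply/eqP => fpos.
  move: Foo; rewrite integralE -/f fpos addye ?ltxx//.
  rewrite eqe_oppLR /= lt_eqF//; exact: le_lt_trans fneg (ltry _).
apply/integrableP; split => //.
rewrite -[fun x => _]/(abse \o f) fune_abse ge0_integralD//.
- by rewrite lte_add_pinfty//; exact: le_lt_trans fneg (ltry _).
- exact: measurable_funepos.
- exact: measurable_funeneg.
Qed.

End integrability.

(** * Entropy as a minimum of Bregman divergences *)

Section entropy.
Local Open Scope ring_scope.
Context {d} {X : measurableType d} {R : realType}.
Variable P : probability X R.
Local Notation integrable1 F := (P.-integrable [set: X] (fun x => (F x)%:E)).

Lemma xlnx_ge (x : R) : 0 < x -> x - 1 <= x * ln x.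
Proof.
move=> x0; have := ler_wpM2l (ltW x0) (ln_ge_1subV x0).
by rewrite mulrBr mulr1 divff// gt_eqF.
Qed.

Variables (g : X -> R) (c : R).
Hypotheses (mg : measurable_fun [set: X] g) (c0 : 0 < c) (cg : forall x, c <= g x).

Let g0 x : 0 < g x. Proof. exact: lt_le_trans (cg x). Qed.

Lemma measurable_xlnx : measurable_fun [set: X] (fun x => g x * ln (g x)).
Proof. by apply: measurable_funM => //; exact: measurableT_comp. Qed.

Lemma Rintegral_lbound : integrable1 g -> c <= \int[P]_x g x.
Proof.
move=> ig; rewrite -[leLHS](Rintegral_cst1 P).
by apply: le_Rintegral => //; exact: integrable_cst1.
Qed.

Lemma Ent_fin (a := \int[P]_x (g x * ln (g x))) (u := \int[P]_x g x) :
  integrable1 g -> integrable1 (fun x => g x * ln (g x)) ->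
  Ent P g = (a - u * ln u)%:E.
Proof.
move=> ig igl; have u0 : 0 < u by exact: lt_le_trans (Rintegral_lbound ig).
rewrite /Ent (integral_Rintegral igl) (integral_Rintegral ig).
by rewrite lne_EFin// -EFinM -EFinB.
Qed.

(** The entropy is a difference of extended reals: if the integral of [g ln g]
    were infinite, so would be the entropy. *)
Lemma Ent_lty_integrable : integrable1 g -> (Ent P g < +oo)%E ->
  integrable1 (fun x => g x * ln (g x)).
Proof.
move=> ig; have u0 := lt_le_trans c0 (Rintegral_lbound ig).
rewrite /Ent (integral_Rintegral ig) lne_EFin// -EFinM => Eoo.
apply: (@lbounded_integrable _ _ _ P 1); first exact: measurable_xlnx.
  by move=> x; have := xlnx_ge (g0 x); have := g0 x; lra.
rewrite ltNge leye_eq; apply/eqP => gl.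
by move: Eoo; rewrite gl -EFinN addye ?ltxx.
Qed.

(** The Bregman divergence of [y ln y] between [y] and [T]. *)
Definition bregman (T y : R) := y * ln (y / T) - y + T.

Lemma bregmanE (T y : R) : 0 < T -> 0 < y ->
  bregman T y = y * ln y - ln T * y - y + T.
Proof. by move=> T0 y0; rewrite /bregman ln_div ?posrE//; ring. Qed.

Lemma bregman_ge0 (T y : R) : 0 < T -> 0 < y -> 0 <= bregman T y.
Proof.
move=> T0 y0; have yT : 0 < y / T by exact: divr_gt0.
have := ler_wpM2l (ltW T0) (xlnx_ge yT); rewrite /bregman.
have -> : T * (y / T - 1) = y - T by field; rewrite gt_eqF.
have -> : T * (y / T * ln (y / T)) = y * ln (y / T) by field; rewrite gt_eqF.
lra.
Qed.

(** Nonnegativity of the divergence at the level [e T] gives linear growth of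
    the divergence at the level [T]. *)
Lemma le_bregman (T y : R) : 0 < T -> 0 < y -> y <= bregman T y + expR 1 * T.
Proof.
move=> T0 y0; have K0 : 0 < expR 1 * T by rewrite mulr_gt0// expR_gt0.
have := @bregman_ge0 (expR 1 * T) y K0 y0.
rewrite !bregmanE// lnM ?posrE// ?expR_gt0// expRK; lra.
Qed.

Lemma measurable_bregman (T : R) : 0 < T ->
  measurable_fun [set: X] (fun x => bregman T (g x)).
Proof.
move=> T0; under eq_fun do rewrite bregmanE//.
apply: measurable_funD => //; apply: measurable_funB => //.
by apply: measurable_funB; [exact: measurable_xlnx|exact: measurable_funM].
Qed.

Lemma Rintegral_bregman (T : R) (a := \int[P]_x (g x * ln (g x)))
    (u := \int[P]_x g x) :
  0 < T -> integrable1 g -> integrable1 (fun x => g x * ln (g x)) ->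
  integrable1 (fun x => bregman T (g x)) /\
  \int[P]_x bregman T (g x) = a - ln T * u - u + T.
Proof.
move=> T0 ig igl.
have i1 := integrable_scale (ln T) ig.
have i2 := integrable_sub igl i1.
have i3 := integrable_sub i2 ig.
have i4 := integrable_add i3 (integrable_cst1 P T).
have bE x := bregmanE T0 (g0 x).
split; first by under eq_fun do rewrite bE.
under eq_Rintegral do rewrite bE.
rewrite RintegralD//; last exact: integrable_cst1.
by rewrite Rintegral_cst1 RintegralB// RintegralB// RintegralZl.
Qed.

(** The difference between the two sides is the divergence between the mean of
    [g] and [T]. Finiteness of the right-hand side alone makes [g] integrable,
    because the divergence dominates [g] up to a constant. *)
Lemma Ent_le_bregman (T : R) : 0 < T ->
  (\int[P]_x (bregman T (g x))%:E < +oo)%E ->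
  integrable1 g /\ (Ent P g <= \int[P]_x (bregman T (g x))%:E)%E.
Proof.
move=> T0 Poo; have iP : integrable1 (fun x => bregman T (g x)).
  apply: (@lbounded_integrable _ _ _ P 0) => //; first exact: measurable_bregman.
  by move=> x; rewrite oppr0 bregman_ge0.
have ig : integrable1 g.
  apply: (@le_integrable1 _ _ _ P _ (fun x => bregman T (g x) + expR 1 * T)) => //.
    by move=> x; rewrite ger0_norm ?(ltW (g0 x))// le_bregman.
  exact: (integrable_add iP (integrable_cst1 P (expR 1 * T))).
have igl : integrable1 (fun x => g x * ln (g x)).
  have i1 := integrable_scale (ln T) ig.
  have i2 := integrable_sub i1 (integrable_cst1 P T).
  apply: eq_integrable (integrable_add (integrable_add iP ig) i2) => // x _.
  by rewrite bregmanE//; congr EFin; ring.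
split => //; rewrite Ent_fin//.
have [_ e] := Rintegral_bregman T0 ig igl.
rewrite (integral_Rintegral iP) lee_fin e.
set u := \int[P]_x g x; have u0 : 0 < u := lt_le_trans c0 (Rintegral_lbound ig).
have := bregman_ge0 T0 u0; rewrite bregmanE//; lra.
Qed.

End entropy.

(** * Entropy of a square and variance of its root *)

Section square_root.
Local Open Scope ring_scope.
Context {d} {X : measurableType d} {R : realType}.
Variable P : probability X R.
Local Notation integrable1 F := (P.-integrable [set: X] (fun x => (F x)%:E)).

Variables (h : X -> R) (c : R).
Hypotheses (mh : measurable_fun [set: X] h) (c0 : 0 < c) (ch : forall x, c <= h x).
Hypothesis ih2 : integrable1 (fun x => h x ^+ 2).

Let p := \int[P]_x h x.
Let u := \int[P]_x h x ^+ 2.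

Let h0 x : 0 < h x. Proof. exact: lt_le_trans (ch x). Qed.

Lemma integrable_root : integrable1 h.
Proof.
apply: (@le_integrable1 _ _ _ _ _ (fun x => 1 + h x ^+ 2)) => //.
  move=> x; rewrite ger0_norm ?(ltW (h0 x))//.
  by have := sqr_ge0 (h x - 1); have := h0 x; lra.
exact: integrable_add (integrable_cst1 P 1) ih2.
Qed.

Let ih := integrable_root.

Lemma root_mean_gt0 : 0 < p.
Proof. exact: lt_le_trans (Rintegral_lbound ch ih). Qed.

Lemma Rintegral_quadratic (a b : R) :
  integrable1 (fun x => a * h x ^+ 2 + b * h x) /\
  \int[P]_x (a * h x ^+ 2 + b * h x) = a * u + b * p.
Proof.
have i1 := integrable_scale a ih2; have i2 := integrable_scale b ih.
split; first exact: integrable_add.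
by rewrite RintegralD// !RintegralZl.
Qed.

Lemma sqr_mean_le_mean_sqr : p ^+ 2 <= u.
Proof.
have [i e] := Rintegral_quadratic 1 (- (2 * p)).
have : - p ^+ 2 <= \int[P]_x (1 * h x ^+ 2 + - (2 * p) * h x).
  rewrite -[leLHS](Rintegral_cst1 P); apply: le_Rintegral => //.
    exact: integrable_cst1.
  by move=> x _; have := sqr_ge0 (h x - p); lra.
rewrite e; lra.
Qed.

Let u0 : 0 < u.
Proof.
by rewrite (lt_le_trans _ sqr_mean_le_mean_sqr)// exprn_gt0// root_mean_gt0.
Qed.

Lemma variance_le_norm_ratio : u - p ^+ 2 <= u * ln (u / p ^+ 2).
Proof.
have p0 := root_mean_gt0.
have r0 : 0 < u / p ^+ 2 by rewrite divr_gt0// exprn_gt0.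
have := ler_wpM2l (ltW u0) (ln_ge_1subV r0).
rewrite (_ : u * (1 - _) = u - p ^+ 2)//.
by field; rewrite (gt_eqF u0) (gt_eqF p0).
Qed.

(** Jensen's inequality for the probability of density [h^2 / u] and the
    function [1 / h], whose mean is [p / u]: the tangent of the logarithm at
    that mean gives a pointwise bound of [h^2 ln h], which is then integrated. *)
Lemma norm_ratio_le_entropy (a := \int[P]_x (h x ^+ 2 * ln (h x ^+ 2))) :
  integrable1 (fun x => h x ^+ 2 * ln (h x ^+ 2)) ->
  u * ln (u / p ^+ 2) <= a - u * ln u.
Proof.
move=> igl; have p0 := root_mean_gt0.
have [i e] := Rintegral_quadratic (2 * (ln u - ln p) + 2) (- (2 * u / p)).
have : \int[P]_x ((2 * (ln u - ln p) + 2) * h x ^+ 2 + - (2 * u / p) * h x) <= a.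
  apply: le_Rintegral => // x _; rewrite lnXn//.
  have r0 : 0 < h x * p / u by rewrite divr_gt0// mulr_gt0.
  have hx2 : 0 < 2 * h x ^+ 2 by rewrite mulr_gt0// exprn_gt0.
  have := ler_wpM2l (ltW hx2) (ln_ge_1subV r0).
  rewrite ln_div ?posrE ?mulr_gt0// lnM ?posrE//.
  have -> : 2 * h x ^+ 2 * (1 - (h x * p / u)^-1) =
    2 * h x ^+ 2 - (2 * u / p) * h x.
    by field; rewrite (gt_eqF u0) (gt_eqF p0) (gt_eqF (h0 x)).
  rewrite mulr2n; lra.
rewrite e ln_div ?posrE ?exprn_gt0// lnXn//.
have -> : - (2 * u / p) * p = - (2 * u) by field; rewrite gt_eqF.
rewrite mulr2n; lra.
Qed.

(** The left-hand side is the integral of [bregman T (h x ^+ 2)], in the form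
    given by [Rintegral_bregman]. *)
Lemma bregman_le_entropy (s i M r : R) (T := (s ^+ 2 + i ^+ 2) / 2)
    (a := \int[P]_x (h x ^+ 2 * ln (h x ^+ 2))) :
  integrable1 (fun x => h x ^+ 2 * ln (h x ^+ 2)) ->
  0 < i -> i <= p -> p <= s ->
  (s - p) ^+ 2 <= M * (u - p ^+ 2) -> (p - i) ^+ 2 <= M * (u - p ^+ 2) ->
  0 <= r -> M <= 2 * r -> 2 * M <= 3 * (1 + r) ->
  a - ln T * u - u + T <= (2 + r) * (a - u * ln u).
Proof.
move=> igl i0 ip ps sM iM r0 Mr Mr'; have p0 := root_mean_gt0.
have T0 : 0 < T.
  by rewrite /T divr_gt0// ltr_wpDl ?sqr_ge0// exprn_gt0.
have V0 : 0 <= u - p ^+ 2 by rewrite subr_ge0 sqr_mean_le_mean_sqr.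
have := two_norms_gap i0 ip ps V0 sM iM Mr Mr'.
rewrite -/T subrKC ln_div ?posrE ?exprn_gt0//.
have H1 := norm_ratio_le_entropy igl; have H2 := variance_le_norm_ratio.
move: H1 H2; rewrite -/a ln_div ?posrE ?exprn_gt0// => H1 H2.
have H3 : r * (u - p ^+ 2) <= r * (a - u * ln u).
  by rewrite ler_wpM2l// (le_trans H2).
lra.
Qed.

End square_root.

(** * Means under two measures at bounded chi-square divergence *)

Section chi_square.
Local Open Scope ring_scope.
Local Open Scope charge_scope.
Context {d} {X : measurableType d} {R : realType}.
Variables P Q : probability X R.

Lemma discriminant_le (V W b : R) : 0 <= V ->
  (forall a, 0 <= a ^+ 2 * V - 2 * a * b + W) -> b ^+ 2 <= W * V.
Proof.
rewrite le_eqVlt => /predU1P[<-|V0] H.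
  have [->|b0] := eqVneq b 0; first by rewrite expr0n/= mulr0.
  have := H ((W + 1) / (2 * b)).
  have -> : 2 * ((W + 1) / (2 * b)) * b = W + 1 by field.
  lra.
have := H (b / V) => /(ler_wpM2r (ltW V0)).
have -> : ((b / V) ^+ 2 * V - 2 * (b / V) * b + W) * V = W * V - b ^+ 2.
  by field; rewrite gt_eqF.
lra.
Qed.

(** With [r] the density of [P] with respect to [Q], the gap between the means
    is the [Q]-integral of [(h - q) (r - 1)], and the Cauchy-Schwarz inequality
    applies. *)
Lemma mean_gap_chi2 (h : X -> R) (M : R) :
  measurable_fun [set: X] h ->
  Q.-integrable [set: X] (fun x => (h x)%:E) ->
  Q.-integrable [set: X] (fun x => (h x ^+ 2)%:E) ->
  P.-integrable [set: X] (fun x => (h x)%:E) ->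
  (chi2 P Q <= M%:E)%E ->
  (\int[P]_x h x - \int[Q]_x h x) ^+ 2 <=
    M * (\int[Q]_x h x ^+ 2 - (\int[Q]_x h x) ^+ 2).
Proof.
move=> mh iQ iQ2 iP; rewrite /chi2; case: asboolP => // PQ.
set rn := 'd _ '/d Q => chiM.
pose r := fine \o rn.
have rnE x : rn x = (r x)%:E by rewrite fineK// Radon_Nikodym_fin_num.
have irn : Q.-integrable setT rn by exact: Radon_Nikodym_integrable.
have ir : Q.-integrable setT (fun x => (r x)%:E).
  by apply: eq_integrable irn => // x _; rewrite rnE.
have mr : measurable_fun setT r by apply/measurable_EFinP/(measurable_int Q).
have r1 : \int[Q]_x r x = 1.
  have : P setT = (\int[Q]_x (r x)%:E)%E.
    rewrite (eq_integral rn) => [|x _]; last by rewrite rnE.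
    exact: (@Radon_Nikodym_integral _ _ _ (charge_of_finite_measure P) Q).
  by rewrite probability_setT /Rintegral => <-.
have {}chiM : (\int[Q]_x ((r x - 1) ^+ 2)%:E <= M%:E)%E.
  rewrite (le_trans _ chiM)//; under [leRHS]eq_integral do rewrite rnE.
  by under [leRHS]eq_integral do rewrite -EFinB -EFin_expe.
have ir2 : Q.-integrable setT (fun x => ((r x - 1) ^+ 2)%:E).
  apply: (@lbounded_integrable _ _ _ Q 0).
  - by apply: measurable_funX; exact: measurable_funB.
  - by move=> x; rewrite oppr0 sqr_ge0.
  - exact: le_lt_trans chiM (ltry _).
set p := \int[P]_x h x; set q := \int[Q]_x h x.
set V := _ - q ^+ 2.
(* The product of the centred factors is dominated by the sum of their
   squares; the integrability of [h * r] follows from it, not conversely. *)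
have icov : Q.-integrable setT (fun x => ((h x - q) * (r x - 1))%:E).
  pose G x := (h x ^+ 2 + - (2 * q) * h x + q ^+ 2) + (r x - 1) ^+ 2.
  have iG : Q.-integrable setT (fun x => (G x)%:E).
    apply: integrable_add => //; apply: integrable_add; last exact: integrable_cst1.
    by apply: integrable_add => //; exact: integrable_scale.
  apply: (le_integrable1 _ _ iG).
    by apply: measurable_funM; exact: measurable_funB.
  move=> x; rewrite /G; have := sqr_ge0 (h x - q - (r x - 1)).
  have := sqr_ge0 (h x - q + (r x - 1)).
  have := sqr_ge0 (h x - q); have := sqr_ge0 (r x - 1).
  by have [_|_] := ger0P ((h x - q) * (r x - 1)); lra.
have cov : \int[Q]_x ((h x - q) * (r x - 1)) = p - q.
  have ihr : Q.-integrable setT (fun x => (h x * r x)%:E).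
    pose G x := (h x - q) * (r x - 1) + h x + q * r x - q.
    suff : Q.-integrable setT (fun x => (G x)%:E).
      by apply: eq_integrable => // x _; congr EFin; rewrite /G; ring.
    have := integrable_add icov iQ; rewrite /G.
    move=> /integrable_add /(_ (integrable_scale q ir)).
    by move=> /integrable_sub; apply; exact: integrable_cst1.
  have hr : \int[Q]_x (h x * r x) = p.
    rewrite /p /Rintegral -(Radon_Nikodym_change_of_variables PQ)//.
    by under [in RHS]eq_integral do rewrite -/rn rnE.
  have -> : (fun x => (h x - q) * (r x - 1)) =
      (fun x => h x * r x - h x - q * r x + q).
    by apply/funext => x; ring.
  have i1 := integrable_sub ihr iQ; have i2 := integrable_scale q ir.
  have i3 := integrable_sub i1 i2.
  rewrite RintegralD//; last exact: integrable_cst1.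
  rewrite RintegralB// RintegralB// RintegralZl// Rintegral_cst1 hr r1 -/q.
  by ring.
have [ivar var] : Q.-integrable setT (fun x => ((h x - q) ^+ 2)%:E) /\
    \int[Q]_x (h x - q) ^+ 2 = V.
  have i1 := integrable_scale (2 * q) iQ; have i2 := integrable_sub iQ2 i1.
  split.
    apply: eq_integrable (integrable_add i2 (integrable_cst1 Q (q ^+ 2))) => //.
    by move=> x _; congr EFin; ring.
  have -> : (fun x => (h x - q) ^+ 2) =
      (fun x => h x ^+ 2 - (2 * q) * h x + q ^+ 2) by apply/funext => x; ring.
  rewrite RintegralD//; last exact: integrable_cst1.
  by rewrite RintegralB// RintegralZl// Rintegral_cst1 /V -/q; ring.
have V0 : 0 <= V by rewrite -var; apply: Rintegral_ge0 => x _; exact: sqr_ge0.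
pose chi := \int[Q]_x (r x - 1) ^+ 2.
have chi_le : chi <= M.
  by rewrite -lee_fin /chi -integral_Rintegral.
apply: (@le_trans _ _ (chi * V)); last by rewrite ler_wpM2r.
apply: discriminant_le => // a.
have -> : a ^+ 2 * V - 2 * a * (p - q) + chi =
  \int[Q]_x (a * (h x - q) - (r x - 1)) ^+ 2.
  have -> : (fun x => (a * (h x - q) - (r x - 1)) ^+ 2) =
      (fun x => a ^+ 2 * (h x - q) ^+ 2 - 2 * a * ((h x - q) * (r x - 1)) +
        (r x - 1) ^+ 2) by apply/funext => x; ring.
  have i1 := integrable_scale (a ^+ 2) ivar.
  have i2 := integrable_scale (2 * a) icov.
  have i3 := integrable_sub i1 i2.
  by rewrite RintegralD// RintegralB// !RintegralZl// var cov.
by apply: Rintegral_ge0 => x _; exact: sqr_ge0.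
Qed.

End chi_square.

(** * Integration against a mixture *)

Section mixture_integral.
Local Open Scope ereal_scope.
Context {dT dX} {Theta : measurableType dT} {X : measurableType dX}
  {R : realType}.
Variables (m : probability Theta R) (mu : Theta -> probability X R).
Hypothesis mmu : measurable_family mu.

Lemma measurable_integral_family (f : X -> \bar R) :
  measurable_fun [set: X] f -> (forall x, 0 <= f x) ->
  measurable_fun [set: Theta] (fun theta => \int[mu theta]_x f x).
Proof. by move=> mf f0; exact: measurable_fun_integral_kernel. Qed.

(** The mixture is the Kleisli composition, in the Giry monad, of [m] with the
    family [mu]. *)
Lemma integral_mixture (f : X -> \bar R) :
  measurable_fun [set: X] f -> (forall x, 0 <= f x) ->
  \int[mixture m mmu]_x f x = \int[m]_theta \int[mu theta]_x f x.
Proof.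
move=> mf f0; pose k theta : giry X R := mu theta.
have mk : measurable_fun [set: Theta] k by exact: measurable_giry_codensity.
transitivity (giry_int (giry_bind (m : giry Theta R) mk) f).
  apply: eq_measure_integral => A mA _.
  rewrite /giry_bind /giry_join/=.
  rewrite giry_int_map//.
  exact: measurable_giry_ev.
by rewrite giry_int_bind.
Qed.

End mixture_integral.

(** * Test functions *)

Section test_functions.
Local Open Scope ereal_scope.
Context {R : realType} {d : nat}.
Implicit Types f : 'rV[R]_d -> R.

Lemma continuous_measurable_rV f : continuous f ->
  measurable_fun [set: borel_rV R d] f.
Proof.
move=> cf; apply: (measurability (@RGenOpens.G R)).
  exact: RGenOpens.measurableE.
move=> _ [_ [a [b ->]] <-]; rewrite setTI.
apply: sub_sigma_algebra.
by move/continuousP: cf; apply; exact: interval_open.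
Qed.

Variable f : 'rV[R]_d -> R.
Hypothesis ft : clsi_test f.

Lemma clsi_test_measurable : measurable_fun [set: borel_rV R d] f.
Proof.
case: ft => _ [df _] _ _; apply: continuous_measurable_rV => x.
exact: differentiable_continuous.
Qed.

Lemma clsi_test_measurable_fisher : measurable_fun [set: borel_rV R d]
  (fun x => euclidean_sqnorm (gradient f x) * expR (f x))%R.
Proof.
apply: measurable_funM; last exact: measurableT_comp clsi_test_measurable.
case: ft => _ [_ cg] _ _; apply: measurable_sum => i.
apply: measurable_funX; apply: continuous_measurable_rV => x.
apply: (@continuous_comp _ _ _ (gradient f) (fun v : 'rV[R]_d => v 0%R i)).
  exact: cg.
exact: coord_continuous.
Qed.

Lemma fisher_integrand_ge0 x :
  (0 <= euclidean_sqnorm (gradient f x) * expR (f x))%R.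
Proof.
by rewrite mulr_ge0 ?expR_ge0// sumr_ge0// => i _; exact: sqr_ge0.
Qed.

Lemma fisher_ge0 (P : probability (borel_rV R d) R) : 0 <= fisher P f.
Proof. by apply: integral_ge0 => x _; rewrite lee_fin fisher_integrand_ge0. Qed.

Lemma clsi_test_expR_lbound : exists2 c : R, (0 < c)%R &
  forall x, (c <= expR (f x / 2))%R.
Proof.
case: ft => _ _ _ [b fb]; exists (expR (b / 2)); first exact: expR_gt0.
by move=> x; rewrite ler_expR ler_pM2r// fb//; exists x.
Qed.

End test_functions.

(** * A reference level common to all components *)

Section reference_level.
Local Open Scope ring_scope.
Context {d} {X : measurableType d} {R : realType} {Theta : Type}.
Variable mu : Theta -> probability X R.
Local Notation integrable1 theta F :=
  ((mu theta).-integrable [set: X] (fun x => (F x)%:E)).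

(** The set [D] is meant to collect the components for which the Fisher term is
    finite; only there are the means of [h] finite and comparable. *)
Lemma uniform_bregman_le_Ent (h : X -> R) (c M : R) (D : set Theta)
    (r := (2 + M) * ln (1 + M) / 4) :
  measurable_fun [set: X] h -> 0 < c -> (forall x, c <= h x) -> 0 <= M ->
  (forall theta, D theta -> integrable1 theta (fun x => h x ^+ 2)) ->
  (forall theta, D theta -> (Ent (mu theta) (fun x => h x ^+ 2)%R < +oo)%E) ->
  (forall theta theta', D theta -> D theta' ->
    (chi2 (mu theta) (mu theta') <= M%:E)%E) ->
  exists2 T : R, 0 < T & forall theta, D theta ->
    (\int[mu theta]_x (bregman T (h x ^+ 2))%:E <=
      (2 + r)%:E * Ent (mu theta) (fun x => h x ^+ 2)%R)%E.
Proof.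
move=> mh c0 ch M0 ih2 Entoo chiM.
have [->|/set0P[theta0 D0]] := eqVneq D set0; first by exists 1.
pose p theta := \int[mu theta]_x h x.
pose V theta := \int[mu theta]_x h x ^+ 2 - p theta ^+ 2.
have ih theta : D theta -> integrable1 theta h.
  by move=> Dt; exact: (integrable_root mh c0 ch (ih2 _ Dt)).
have pc theta : D theta -> c <= p theta.
  by move=> /ih; exact: Rintegral_lbound.
have gap theta theta' : D theta -> D theta' ->
    (p theta' - p theta) ^+ 2 <= M * V theta.
  by move=> Dt Dt'; apply: mean_gap_chi2; auto.
have V0 theta : D theta -> 0 <= M * V theta.
  move=> Dt; rewrite mulr_ge0// /V subr_ge0.
  exact: (sqr_mean_le_mean_sqr mh c0 ch (ih2 _ Dt)).
have sgap theta theta' : D theta -> D theta' ->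
    `|p theta' - p theta| <= Num.sqrt (M * V theta).
  by move=> Dt Dt'; rewrite -sqrtr_sqr ler_wsqrtr// gap.
(* Each single component bounds all other means, so the set of means is
   bounded even though no bound on the variances is uniform. *)
set S := p @` D.
have S0 : S !=set0 by exists (p theta0), theta0.
have ubS : has_ubound S.
  exists (p theta0 + Num.sqrt (M * V theta0)) => _ [theta Dt <-].
  by rewrite -lerBlDl (le_trans (ler_norm _))// sgap.
have lbS : has_lbound S by exists c => _ [theta Dt <-]; exact: pc.
set s := sup S; set i := inf S.
have i0 : 0 < i.
  by rewrite (lt_le_trans c0)//; apply: lb_le_inf => // _ [theta Dt <-]; exact: pc.
have r0 : 0 <= r by rewrite /r; have := mulDln_ge M0; lra.
exists ((s ^+ 2 + i ^+ 2) / 2).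
  by rewrite divr_gt0// ltr_wpDl ?sqr_ge0// exprn_gt0.
move=> theta Dt.
have ps : p theta <= s by apply: ub_le_sup => //; exists theta.
have ip : i <= p theta by apply: ge_inf => //; exists theta.
have sM : (s - p theta) ^+ 2 <= M * V theta.
  rewrite -[leRHS]sqr_sqrtr ?V0// ler_sqr ?nnegrE ?sqrtr_ge0 ?subr_ge0//.
  rewrite lerBlDl; apply: ge_sup => // _ [theta' Dt' <-].
  by rewrite -lerBlDl (le_trans (ler_norm _))// sgap.
have iM : (p theta - i) ^+ 2 <= M * V theta.
  rewrite -[leRHS]sqr_sqrtr ?V0// ler_sqr ?nnegrE ?sqrtr_ge0 ?subr_ge0//.
  rewrite lerBlDr -lerBlDl; apply: lb_le_inf => // _ [theta' Dt' <-].
  by rewrite lerBlDl -lerBlDr (le_trans (ler_norm _))// distrC sgap.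
have mh2 : measurable_fun [set: X] (fun x => h x ^+ 2) by exact: measurable_funX.
have c20 : 0 < c ^+ 2 by exact: exprn_gt0.
have ch2 x : c ^+ 2 <= h x ^+ 2.
  by rewrite ler_sqr ?nnegrE ?(ltW c0)// (le_trans (ltW c0)).
have ih2l := Ent_lty_integrable mh2 c20 ch2 (ih2 _ Dt) (Entoo _ Dt).
have T0 : 0 < (s ^+ 2 + i ^+ 2) / 2.
  by rewrite divr_gt0// ltr_wpDl ?sqr_ge0// exprn_gt0.
have [ibreg ebreg] := Rintegral_bregman c20 ch2 T0 (ih2 _ Dt) ih2l.
rewrite (integral_Rintegral ibreg) ebreg (Ent_fin c20 ch2 (ih2 _ Dt) ih2l).
rewrite -EFinM lee_fin.
have Mr := mulDln_ge M0; have Mr' := mulDln_ge_far M0.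
by apply: (bregman_le_entropy mh c0 ch (ih2 _ Dt) ih2l i0 ip ps sM iM r0);
  rewrite /r; lra.
Qed.

End reference_level.

(** * The convex log-Sobolev inequality for mixtures *)

Section mixture_clsi.
Local Open Scope ereal_scope.
Context (R : realType) (d : nat) (dT : measure_display)
  (Theta : measurableType dT) (m : probability Theta R)
  (mu : Theta -> probability (borel_rV R d) R).
Hypothesis mmu : measurable_family mu.

Lemma fisher_mixture (f : 'rV[R]_d -> R) : clsi_test f ->
  fisher (mixture m mmu) f = \int[m]_theta fisher (mu theta) f.
Proof.
move=> ft; rewrite /fisher integral_mixture//.
  by apply/measurable_EFinP; exact: clsi_test_measurable_fisher.
by move=> x; rewrite lee_fin fisher_integrand_ge0.
Qed.

Lemma clsi_mixture (C M : R) (r := ((2 + M) * ln (1 + M) / 4)%R) :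
  (0 < C)%R -> (0 <= M)%R ->
  (forall theta, clsi (mu theta) C) ->
  (forall theta theta', chi2 (mu theta) (mu theta') <= M%:E) ->
  clsi (mixture m mmu) (C * (2 + r)).
Proof.
move=> C0 M0 muC muM.
have r0 : (0 <= r)%R by rewrite /r; have := mulDln_ge M0; lra.
have K0 : (0 < C * (2 + r) / 2)%R by rewrite divr_gt0// mulr_gt0//; lra.
split => [|f ft fish_lty]; first by lra.
have [c c0 ch] := clsi_test_expR_lbound ft.
pose h x := expR (f x / 2).
have mh : measurable_fun [set: borel_rV R d] h.
  apply: measurableT_comp => //.
  exact: measurable_funM (clsi_test_measurable ft) _.
have expR_sqr x : expR (f x) = (h x ^+ 2)%R.
  by rewrite /h -expRM_natl; congr expR; field.
have gE : (fun x => expR (f x)) = (fun x => h x ^+ 2)%R.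
  exact/funext/expR_sqr.
have EgE : (fun x => (expR (f x))%:E) = (fun x => (h x ^+ 2)%:E).
  by apply/funext => x; rewrite expR_sqr.
pose D := [set theta | fisher (mu theta) f < +oo].
have muf theta : D theta ->
    (mu theta).-integrable setT (fun x => (h x ^+ 2)%:E) /\
    Ent (mu theta) (fun x => h x ^+ 2)%R <= (C / 2)%:E * fisher (mu theta) f.
  rewrite /D/= => Dt; have [_ /(_ f ft)] := muC theta; rewrite gE EgE; apply.
  by rewrite lte_mul_pinfty// lee_fin divr_ge0// ltW.
have [T T0 DT] : exists2 T : R, (0 < T)%R & forall theta, D theta ->
    \int[mu theta]_x (bregman T (h x ^+ 2))%:E <=
      (2 + r)%:E * Ent (mu theta) (fun x => h x ^+ 2)%R.
  apply: (uniform_bregman_le_Ent mh c0 ch M0) => // theta Dt.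
    by have [] := muf _ Dt.
  have [_ /le_lt_trans] := muf _ Dt; apply.
  by rewrite lte_mul_pinfty// lee_fin divr_ge0// ltW.
have fisher0 theta : 0 <= fisher (mu theta) f by exact: fisher_ge0.
have muT theta : \int[mu theta]_x (bregman T (h x ^+ 2))%:E <=
    (C * (2 + r) / 2)%:E * fisher (mu theta) f.
  (* Outside [D] the right-hand side is infinite. *)
  have [Dt|] := pselect (D theta); last first.
    rewrite /D/= ltey => /negP; rewrite negbK => /eqP ->.
    by rewrite gt0_muley ?leey// lte_fin.
  rewrite (le_trans (DT _ Dt))//; have [_ E] := muf _ Dt.
  rewrite (_ : C * (2 + r) / 2 = (2 + r) * (C / 2))%R; last by field.
  by rewrite EFinM -muleA lee_pmul2l// lte_fin; lra.
have c20 : (0 < c ^+ 2)%R by exact: exprn_gt0.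
have ch2 x : (c ^+ 2 <= h x ^+ 2)%R.
  by rewrite ler_sqr ?nnegrE ?(ltW c0) ?expR_ge0//; exact: ch.
have mh2 : measurable_fun [set: borel_rV R d] (fun x => h x ^+ 2)%R.
  exact: measurable_funX.
have mbreg : measurable_fun [set: borel_rV R d] (fun x => (bregman T (h x ^+ 2))%:E).
  by apply/measurable_EFinP; exact: (measurable_bregman mh2 c20 ch2 T0).
have breg0 x : 0 <= (bregman T (h x ^+ 2))%:E.
  by rewrite lee_fin bregman_ge0// exprn_gt0// expR_gt0.
have mixT : \int[mixture m mmu]_x (bregman T (h x ^+ 2))%:E <=
    (C * (2 + r) / 2)%:E * fisher (mixture m mmu) f.
  rewrite integral_mixture// fisher_mixture//.
  have mf : measurable_fun [set: Theta] (fun theta => fisher (mu theta) f).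
    apply: measurable_integral_family => //.
      by apply/measurable_EFinP; exact: clsi_test_measurable_fisher.
    by move=> x; rewrite lee_fin fisher_integrand_ge0.
  rewrite -ge0_integralZl//; last by rewrite lee_fin ltW.
  apply: ge0_le_integral => //.
  - by move=> theta _; exact: integral_ge0.
  - exact: measurable_integral_family.
  - exact: measurable_funeM.
have [ig Entbreg] := Ent_le_bregman mh2 c20 ch2 T0 (le_lt_trans mixT fish_lty).
rewrite gE EgE; split => //; exact: le_trans Entbreg mixT.
Qed.

End mixture_clsi.

(** * Optimal constants *)

Section clsi_constant.
Local Open Scope ereal_scope.

Lemma chi2_ge0 {d} {X : measurableType d} {R : realType}
  (P Q : probability X R) : 0 <= chi2 P Q.
Proof.
rewrite /chi2; case: ifPn => // _.
by apply: integral_ge0 => x _; exact: sqre_ge0.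
Qed.

Context {R : realType} {d : nat}.
Implicit Types P : probability (borel_rV R d) R.

Lemma clsi_constant_ge0 P : 0 <= clsi_constant P.
Proof. by apply: le_ereal_inf_tmp => _ [C [C0 _] <-]; rewrite lee_fin ltW. Qed.

Lemma clsi_constant_le P C : clsi P C -> clsi_constant P <= C%:E.
Proof. by move=> PC; apply: ereal_inf_lbound; exists C. Qed.

Lemma clsi_le P C C' : (C <= C')%R -> clsi P C -> clsi P C'.
Proof.
move=> CC' [C0 PC]; have C'0 := lt_le_trans C0 CC'.
split => // f ft fish.
have le : (C / 2)%:E * fisher P f <= (C' / 2)%:E * fisher P f.
  by rewrite lee_wpmul2r ?fisher_ge0// lee_fin ler_pM2r.
have [ig EC] := PC f ft (le_lt_trans le fish).
by split => //; exact: le_trans EC le.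
Qed.

(** An admissible constant lies below [C], and admissible constants are upward
    closed. The infimum itself need not be admissible, as it can be zero. *)
Lemma clsi_constant_lt P C : clsi_constant P < C%:E -> clsi P C.
Proof.
by move=> /ereal_inf_lt[_ [C' PC' <-]]; rewrite lte_fin => /ltW /clsi_le; exact.
Qed.

End clsi_constant.

Local Open Scope ereal_scope.

Theorem theorem4p5 (R : realType) (d : nat)
    (dT : measure_display) (Theta : measurableType dT)
    (m : probability Theta R)
    (mu : Theta -> probability (borel_rV R d) R)
    (mmu : measurable_family mu) :
  let mu_mix : probability (borel_rV R d) R := mixture m mmu in
  let C_Theta : \bar R :=
    ereal_sup [set clsi_constant (mu theta) | theta in [set: Theta]] in
  let M_Theta : \bar R :=
    ereal_sup [set chi2 (mu theta) (mu theta')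
              | theta in [set: Theta] & theta' in [set: Theta]] in
  C_Theta < +oo ->
  M_Theta < +oo ->
  (exists C : R, clsi mu_mix C) /\
  clsi_constant mu_mix <=
    C_Theta * (2%:E + (1 / 4)%:E * (2%:E + M_Theta) * lne (1 + M_Theta)).
Proof.
move=> mu_mix C_Theta M_Theta CTlt MTlt.
(* A probability space is nonempty, hence both suprema are nonnegative. *)
have [theta0 _] : [set: Theta] !=set0.
  apply/set0P/eqP => T0; have := @probability_setT _ _ _ m.
  by rewrite T0 measure0 => /esym/eqP; rewrite onee_eq0.
have CT0 : 0 <= C_Theta.
  rewrite (le_trans (clsi_constant_ge0 (mu theta0)))//.
  by apply: ereal_sup_ubound; exists theta0.
have MT0 : 0 <= M_Theta.
  rewrite (le_trans (chi2_ge0 (mu theta0) (mu theta0)))//.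
  by apply: ereal_sup_ubound; exists theta0 => //; exists theta0.
have CTE : C_Theta = (fine C_Theta)%:E by rewrite fineK// ge0_fin_numE.
have MTE : M_Theta = (fine M_Theta)%:E by rewrite fineK// ge0_fin_numE.
set C := fine C_Theta in CTE; set M := fine M_Theta in MTE.
have C0 : (0 <= C)%R by rewrite -lee_fin -CTE.
have M0 : (0 <= M)%R by rewrite -lee_fin -MTE.
have muM theta theta' : chi2 (mu theta) (mu theta') <= M%:E.
  by rewrite -MTE; apply: ereal_sup_ubound; exists theta => //; exists theta'.
have muC C' theta : (C < C')%R -> clsi (mu theta) C'.
  move=> CC'; apply: clsi_constant_lt; rewrite (@le_lt_trans _ _ C%:E) ?lte_fin//.
  by rewrite -CTE; apply: ereal_sup_ubound; exists theta.
pose K := (2 + (2 + M) * ln (1 + M) / 4)%R.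
have K0 : (0 < K)%R by rewrite /K; have := mulDln_ge M0; lra.
have mixC C' : (C < C')%R -> clsi mu_mix (C' * K).
  move=> CC'; apply: clsi_mixture => //; first by lra.
  by move=> theta; exact: muC.
split; first by exists ((C + 1) * K)%R; apply: mixC; rewrite ltrDl.
have -> : C_Theta * (2%:E + (1 / 4)%:E * (2%:E + M_Theta) * lne (1 + M_Theta)) =
    (C * K)%:E.
  rewrite CTE MTE -[1 + M%:E]EFinD lne_EFin; last by lra.
  by rewrite -!EFinD -!EFinM; congr EFin; rewrite /K; field.
apply/lee_addgt0Pr => e e0.
have CeC : (C < C + e / K)%R by rewrite ltrDl divr_gt0.
apply: (le_trans (clsi_constant_le (mixC _ CeC))).
by rewrite -EFinD lee_fin mulrDl divfK// gt_eqF.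
Qed.
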